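(* Let $n \ge 1$ and let $T_1=([n], E_1)$ and $T_2=([n], E_2)$ be two tournaments on the same vertex set $[n]$. Then there is a vertex $\mu \in [n]$ such that $i \Rightarrow \mu$ for every $i \in [n]$; that is, for every $i\in[n]$ at least one of the following holds: $i=\mu$, or $(i,\mu)\in E_1$, or $(i,\mu)\in E_2$, or there exists $k\in[n]$ with $(i,k)\in E_1$ and $(k,\mu)\in E_2$.
   Context: $[n]=\{1,\dots,n\}$. A tournament $T=([n],E)$ is a directed graph without loops on vertex set $[n]$ such that for every two distinct vertices $i,j$ exactly one of $(i,j)$, $(j,i)$ belongs to $E$. The tournaments $T_1$ and $T_2$ are arbitrary and need not be related. For $i,j\in[n]$, the relation $i\Rightarrow j$ (with respect to the ordered pair $(T_1,T_2)$) means: $i=j$, or $(i,j)\in E_1$, or $(i,j)\in E_2$, or there exists $k$ such that $(i,k)\in E_1$ and $(k,j)\in E_2$. *)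

(* Defs.v *)
From mathcomp Require Import all_boot.

Set Implicit Arguments.
Unset Strict Implicit.
Unset Printing Implicit Defensive.

(* The vertex set [n] = {1, ..., n} is represented by 'I_n = {0, ..., n-1};
   the edge set is a boolean relation, and (+) is exclusive or. *)
Definition tournament (n : nat) (E : rel 'I_n) : Prop :=
  (forall i : 'I_n, ~~ E i i) /\
  (forall i j : 'I_n, i != j -> E i j (+) E j i).

Definition reaches (n : nat) (E1 E2 : rel 'I_n) (i j : 'I_n) : Prop :=
  i = j \/ E1 i j \/ E2 i j \/ exists k : 'I_n, E1 i k /\ E2 k j.

(* Main.v *)
Require Import Defs.
From mathcomp Require Import all_boot.

(** If no [mu] works, every vertex [j] has a vertex [f j] that does not reach
    it, which forces the closed [E1]-out-neighbourhood of [f j] to lie inside the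
    [E2]-out-neighbourhood of [j].  This persists on a set [S] of vertices that
    [f] permutes; there, summing the out-degrees over [S] shows that [E2] has at
    least [#|S|] more arcs inside [S] than [E1], whereas both tournaments have
    ['C(#|S|, 2)]. *)

(** A nonempty set of least size among those that [f] maps into themselves works: its image is again
    such a set, so minimality forces equality. *)
Lemma exists_permuted_set (T : finType) (f : T -> T) (x : T) :
  exists S : {set T}, [/\ S != set0, f @: S = S & {in S &, injective f}].
Proof.
pose closed_set (S : {set T}) := (S != set0) && (f @: S \subset S).
have setT_closed : closed_set setT.
  by rewrite /closed_set subsetT andbT; apply/set0Pn; exists x; rewrite inE.
case: (arg_minnP (fun S : {set T} => #|S|) setT_closed) => S /andP[S0 fS] minS.
have fSE : f @: S = S.
  apply/eqP; rewrite eqEcard fS minS // /closed_set imsetS // andbT.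
  by have [y yS] := set0Pn _ S0; apply/set0Pn; exists (f y); apply: imset_f.
by exists S; split=> //; apply/imset_injP; rewrite fSE.
Qed.

(** Each ordered pair is counted with its reverse. The right side does not mention [E], so any two
    tournaments have equally many arcs inside [S]. *)
Lemma tournament_arcs (n : nat) (E : rel 'I_n) (S : {set 'I_n}) :
  tournament E ->
  (\sum_(i in S) \sum_(j in S) E i j).*2 =
  \sum_(i in S) \sum_(j in S) (i != j).
Proof.
move=> [irrE totE]; rewrite -addnn {2}exchange_big -big_split /=.
apply: eq_bigr => i _; rewrite -big_split /=; apply: eq_bigr => j _.
have [->|/totE] := eqVneq i j; first by rewrite (negbTE (irrE j)).
by case: (E i j) (E j i) => [] [].
Qed.

Lemma not_reached_out_neighbours (n : nat) (E1 E2 : rel 'I_n) (i j : 'I_n) :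
  tournament E1 -> tournament E2 -> ~ reaches E1 E2 i j ->
  E2 j i /\ forall k, E1 i k -> E2 j k.
Proof.
move=> [_ totE1] [_ totE2] nreach.
have E2N k : k != j -> ~~ E2 k j -> E2 j k.
  by move=> /totE2; case: (E2 k j).
split=> [|k E1ik].
  apply: E2N; first by apply/eqP => eij; apply: nreach; left.
  by apply/negP => E2ij; apply: nreach; right; right; left.
apply: E2N; first by apply/eqP => ekj; apply: nreach; rewrite -ekj; right; left.
by apply/negP => E2kj; apply: nreach; do 3!right; exists k.
Qed.

Lemma reachesP (n : nat) (E1 E2 : rel 'I_n) (i j : 'I_n) :
  reflect (reaches E1 E2 i j)
    [|| i == j, E1 i j, E2 i j | [exists k, E1 i k && E2 k j]].
Proof.
apply: (iffP or4P) => [[/eqP|||/existsP[k /andP[]]]|[/eqP|[|[|[k []]]]]].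
- by left.
- by right; left.
- by right; right; left.
- by do 3!right; exists k.
- by constructor 1.
- by constructor 2.
- by constructor 3.
- by move=> ik kj; constructor 4; apply/existsP; exists k; rewrite ik.
Qed.

Theorem corollary2 (n : nat) (E1 E2 : rel 'I_n)
    (hn : 1 <= n) (hE1 : tournament E1) (hE2 : tournament E2) :
  exists mu : 'I_n, forall i : 'I_n, reaches E1 E2 i mu.
Proof.
have [/existsP[mu /forallP reach_mu]|no_mu] := boolP [exists mu, forall i : 'I_n,
    [|| i == mu, E1 i mu, E2 i mu | [exists k, E1 i k && E2 k mu]]].
  by exists mu => i; apply/reachesP.
have /fin_all_exists[f fP] : forall j, exists i, ~ reaches E1 E2 i j.
  move=> j; move/existsPn/(_ j)/forallPn: no_mu => [i /reachesP nij].
  by exists i.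
have [S [S0 fS f_inj]] := exists_permuted_set _ f (Ordinal hn).
(* The extra 1 is the vertex [f j] itself: [E2] has an arc to it from [j], while [E1] has no loop
   there. *)
have lt_deg j : j \in S ->
    \sum_(k in S) E1 (f j) k + 1 <= \sum_(k in S) E2 j k.
  move=> jS; have fjS : f j \in S by rewrite -fS imset_f.
  have [E2jf subE] := not_reached_out_neighbours _ _ _ _ _ hE1 hE2 (fP j).
  rewrite (bigD1 (f j)) //= [leqRHS](bigD1 (f j)) //= E2jf.
  rewrite (negbTE (hE1.1 _)) add0n addnC leq_add2l.
  by apply: leq_sum => k _; case: (E1 _ k) (subE k) => // ->.
have := leq_sum (index_enum _) lt_deg.
(* As [f] permutes [S], the [E1]-degrees of the [f j] sum to the [E1]-arcs inside [S]; equal arc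
   counts then leave [#|S| <= 0]. *)
rewrite big_split /= sum1_card -(big_imset (fun i => \sum_(k in S) E1 i k)) //=.
rewrite fS (double_inj (etrans (tournament_arcs _ _ S hE1)
                               (esym (tournament_arcs _ _ S hE2)))).
by rewrite -[leqRHS]addn0 leq_add2l leqn0 cards_eq0 (negbTE S0).
Qed.
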